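(* Let $p\geq 5$ be a prime, let $\underline{a}=\{a_n\}_{n=0}^\infty$ be an increasing sequence $a_0<a_1<\cdots$ of non-negative integers, and put $y_n=p^{a_n}$. Then the set $L_{\underline{a},p}=\{0\}\cup\{\pm y_n\mid n\in\mathbb{N}\}$ is quasi-convex in $\mathbb{J}_p$.
   Context: $\mathbb{N}=\{0,1,2,\dots\}$. $\mathbb{J}_p$ is the compact additive group of $p$-adic integers. Let $\mathbb{T}=\mathbb{R}/\mathbb{Z}$ with quotient map $\pi\colon\mathbb{R}\to\mathbb{T}$, and $\mathbb{T}_+=\pi([-\frac14,\frac14])$. For an abelian topological group $G$, $\widehat{G}$ is the group of continuous homomorphisms (characters) $G\to\mathbb{T}$. For $E\subseteq G$ and $A\subseteq\widehat{G}$ put $E^\triangleright=\{\chi\in\widehat{G}\mid\chi(E)\subseteq\mathbb{T}_+\}$ and $A^\triangleleft=\{x\in G\mid\chi(x)\in\mathbb{T}_+\text{ for all }\chi\in A\}$. A set $E\subseteq G$ is quasi-convex in $G$ if $E=E^{\triangleright\triangleleft}$. *)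

(* Defs.v *)
From HB Require Import structures.
From mathcomp Require Import all_boot all_order all_algebra.
From mathcomp Require Import all_classical all_reals all_analysis.

Set Implicit Arguments.
Unset Strict Implicit.
Unset Printing Implicit Defensive.

Import Order.TTheory GRing.Theory Num.Theory.
Import numFieldNormedType.Exports.

Local Open Scope classical_set_scope.
Local Open Scope ring_scope.
Local Open Scope quotient_scope.

Definition integers (R : realType) : {pred R} := fun x => x \is a Num.int.

Lemma integers_zmod_closed (R : realType) : zmod_closed (@integers R).
Proof. by split=> [|x y]; [exact: rpred0 | exact: rpredB]. Qed.
HB.instance Definition _ (R : realType) :=
  GRing.isZmodClosed.Build R (@integers R) (@integers_zmod_closed R).

(* R/Z with its quotient group structure and its quotient topology. *)
Definition circle (R : realType) : Type :=
  quotient_topology {ideal_quot (@integers R)}.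
HB.instance Definition _ (R : realType) := Topological.on (circle R).
HB.instance Definition _ (R : realType) := Quotient.on (circle R).
HB.instance Definition _ (R : realType) := GRing.isZmodule.Build (circle R)
  (@Quotient.addqA R (@integers R)) (@Quotient.addqC R (@integers R))
  (@Quotient.add0q R (@integers R)) (@Quotient.addNq R (@integers R)).

Section Circle.
Variable R : realType.

Definition circle_pi (x : R) : circle R := \pi_(circle R) x.
Lemma circle_piB : zmod_morphism circle_pi.
Proof. by move=> x y; exact: (raddfB (\pi_({ideal_quot (@integers R)}))). Qed.
HB.instance Definition _ :=
  GRing.isZmodMorphism.Build R (circle R) circle_pi circle_piB.

Lemma circle_pi_eqP (x y : R) :
  circle_pi x = circle_pi y <-> x - y \is a Num.int.
Proof.
have E := @Quotient.idealrBE R (@integers R) x y.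
split=> h; first by suff: x - y \in @integers R by []; rewrite E; apply/eqP.
by have := E; rewrite [LHS]h => /esym/eqP.
Qed.

Lemma circle_pi_continuous : continuous circle_pi.
Proof. exact: pi_continuous. Qed.

Lemma circle_pi_nbhs (x : R) (U : set (circle R)) :
  nbhs (circle_pi x) U <-> nbhs x (circle_pi @^-1` U).
Proof.
split; first exact: circle_pi_continuous.
rewrite nbhsE => -[V [oV Vx] VU]; rewrite nbhsE.
exists (circle_pi @` V); last first.
  by move=> _ [y Vy <-]; exact: VU.
split; last by exists x.
suff: open (circle_pi @^-1` (circle_pi @` V)) by [].
have -> : circle_pi @^-1` (circle_pi @` V) =
    \bigcup_(k : int) (fun y : R => y + k%:~R) @^-1` V.
  apply/seteqP; split => [y [z Vz]|y [k _ /= Vk]].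
    move/circle_pi_eqP => /intrP [k zyk]; exists k => //=.
    by rewrite -zyk addrC subrK.
  exists (y + k%:~R) => //; apply/circle_pi_eqP.
  by rewrite addrC addKr; apply: intr_int.
apply: bigcup_open => k _; apply: open_comp => // y _.
by apply: cvgD; [exact: cvg_id | exact: cvg_cst].
Qed.

Lemma circle_sub_continuous :
  continuous (fun x : circle R * circle R => x.1 - x.2).
Proof.
move=> [s t]; rewrite -[s]reprK -[t]reprK.
move: (repr s) (repr t) => x y {s t} U /=.
rewrite -[X in X - _]/(circle_pi x) -[X in _ - X]/(circle_pi y) -circle_piB.
move=> /circle_pi_nbhs hU.
have := @sub_continuous R (x, y) _ hU => -[[A B] /= [Ax By] AB].
exists (circle_pi @` A, circle_pi @` B) => /=.
  by split; apply/circle_pi_nbhs; apply: filterS (_ : nbhs _ _);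
    [|exact: Ax| |exact: By]; move=> z; exists z.
move=> _ [/= [u Au <-] [v Bv <-]].
by rewrite -circle_piB; exact: (AB (u, v)).
Qed.

HB.instance Definition _ :=
  PreTopologicalNmodule_isTopologicalZmodule.Build (circle R)
    circle_sub_continuous.
End Circle.

(* The inverse limit of the rings Z/p^m for m >= 1, as a subspace of the
   product of the discrete spaces Z/p^m. The coordinate [residue x n] is the
   class of x modulo p^(n+1): starting at p^1 keeps every modulus at least 2
   (for p >= 2), so that ['Z_(p ^ n.+1)] really is the ring Z/p^(n+1). For
   p = 0 and p = 1 the type is well defined but meaningless. *)
Record padic_int (p : nat) := PadicInt {
  residue : forall n, 'Z_(p ^ n.+1);
  residueS : forall n, residue n = (residue n.+1)%:R }.
Arguments residueS {p} x n : rename.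

Section PadicInt.
Variable p : nat.
Implicit Types x y z : padic_int p.
HB.instance Definition _ := gen_eqMixin (padic_int p).
HB.instance Definition _ := gen_choiceMixin (padic_int p).

Lemma padicP x y : (forall n, residue x n = residue y n) -> x = y.
Proof.
case: x y => [x hx] [y hy] /= xy.
have {xy} : x = y by apply: functional_extensionality_dep.
by move=> xy; case: y / xy hy => hy; congr PadicInt; exact: Prop_irrelevance.
Qed.

Local Notation N n := (Zp_trunc (p ^ n.+1)).+2.

Lemma dvdn_Zp_trunc n : (N n %| N n.+1)%N.
Proof.
case: p => [|[|q]]; [by rewrite !exp0n|by rewrite !exp1n|].
have q_gt1 m : (1 < q.+2 ^ m.+1)%N.
  by rewrite expnS (leq_trans _ (leq_pmulr _ _)) ?expn_gt0.
by rewrite !Zp_cast // [(q.+2 ^ n.+2)%N]expnS dvdn_mull.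
Qed.

Lemma Zp_natr_mod n (k : nat) : ((k %% N n.+1)%N%:R : 'Z_(p ^ n.+1)) = k%:R.
Proof.
by apply: val_inj; rewrite !Zp_nat /= modn_dvdm // dvdn_Zp_trunc.
Qed.

Fact padic_zeroS n : (0 : 'Z_(p ^ n.+1)) = (0%R : 'Z_(p ^ n.+2))%:R.
Proof. by []. Qed.
Fact padic_oneS n : (1 : 'Z_(p ^ n.+1)) = (1%R : 'Z_(p ^ n.+2))%:R.
Proof. by rewrite (Zp_natr_mod n 1). Qed.
Fact padic_oppS x n : - residue x n = (- residue x n.+1)%R%:R.
Proof.
have Nx0 :
    ((N n.+1 - residue x n.+1 + residue x n.+1)%N%:R : 'Z_(p ^ n.+1)) = 0.
  rewrite (subnK (ltnW (ltn_ord _))).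
  rewrite -(Zp_natr_mod n).
  by rewrite modnn.
rewrite [RHS](Zp_natr_mod n); apply/eqP.
rewrite eq_sym -addr_eq0 (residueS x n) -natrD.
exact/eqP.
Qed.
Fact padic_addS x y n :
  residue x n + residue y n = (residue x n.+1 + residue y n.+1)%R%:R.
Proof. by rewrite [RHS]Zp_natr_mod natrD -!residueS. Qed.
Fact padic_mulS x y n :
  residue x n * residue y n = (residue x n.+1 * residue y n.+1)%R%:R.
Proof. by rewrite [RHS]Zp_natr_mod natrM -!residueS. Qed.

Definition padic_zero := PadicInt padic_zeroS.
Definition padic_one := PadicInt padic_oneS.
Definition padic_opp x := PadicInt (padic_oppS x).
Definition padic_add x y := PadicInt (padic_addS x y).
Definition padic_mul x y := PadicInt (padic_mulS x y).

Fact padic_addA : associative padic_add.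
Proof. by move=> x y z; apply: padicP => n /=; rewrite addrA. Qed.
Fact padic_addC : commutative padic_add.
Proof. by move=> x y; apply: padicP => n /=; rewrite addrC. Qed.
Fact padic_add0 : left_id padic_zero padic_add.
Proof. by move=> x; apply: padicP => n /=; rewrite add0r. Qed.
Fact padic_addN : left_inverse padic_zero padic_opp padic_add.
Proof. by move=> x; apply: padicP => n /=; rewrite addNr. Qed.
HB.instance Definition _ := GRing.isZmodule.Build (padic_int p)
  padic_addA padic_addC padic_add0 padic_addN.

Fact padic_mulA : associative padic_mul.
Proof. by move=> x y z; apply: padicP => n /=; rewrite mulrA. Qed.
Fact padic_mulC : commutative padic_mul.
Proof. by move=> x y; apply: padicP => n /=; rewrite mulrC. Qed.
Fact padic_mul1 : left_id padic_one padic_mul.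
Proof. by move=> x; apply: padicP => n /=; rewrite mul1r. Qed.
Fact padic_mulDl : left_distributive padic_mul +%R.
Proof. by move=> x y z; apply: padicP => n /=; rewrite mulrDl. Qed.
Fact padic_one_neq0 : padic_one != 0.
Proof.
apply/eqP => /(congr1 (fun x => residue x 0%N)) /= /eqP.
by rewrite oner_eq0.
Qed.
HB.instance Definition _ := GRing.Zmodule_isComNzRing.Build (padic_int p)
  padic_mulA padic_mulC padic_mul1 padic_mulDl padic_one_neq0.

HB.instance Definition _ := Topological.copy (padic_int p)
  (initial_topology (@residue p : padic_int p ->
     prod_topology (fun n => discrete_topology 'Z_(p ^ n.+1)))).

Lemma residue_continuous n :
  continuous (fun x => residue x n : discrete_topology 'Z_(p ^ n.+1)).
Proof.
move=> x; apply: (@continuous_comp _ _ _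
  (@residue p : padic_int p ->
     prod_topology (fun n => discrete_topology 'Z_(p ^ n.+1)))
  (fun f => f n)).
  exact: initial_continuous.
exact: proj_continuous.
Qed.

Lemma cvg_residue (F : set_system (padic_int p)) (x : padic_int p) :
  Filter F ->
  (forall n, \forall y \near F, residue y n = residue x n) -> F --> x.
Proof.
move=> FF Fx; rewrite /= => U; rewrite nbhsE => -[_ [[V oV <-] /= Vx] VU].
apply: filterS VU _.
have cvgE : nbhs (@residue p @ F) `=>`
    nbhs (residue x : prod_topology (fun n => discrete_topology 'Z_(p ^ n.+1))).
  apply/cvg_sup => n W; rewrite nbhsE => -[_ [[A oA <-] /= Ax] AW].
  apply: filterS AW _; apply: filterS (Fx n) => y /= yx.
  by rewrite yx.
by apply: cvgE; exact: open_nbhs_nbhs.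
Qed.

Lemma padic_sub_continuous :
  continuous (fun x : padic_int p * padic_int p => x.1 - x.2).
Proof.
have H n (x : padic_int p) : nbhs x [set y | residue y n = residue x n].
  have := @residue_continuous n x [set residue x n].
  by apply; exact: (@discrete_set1 (discrete_topology 'Z_(p ^ n.+1))).
move=> [x y] /=; apply: cvg_residue => n; rewrite near_map.
by exists ([set u | residue u n = residue x n],
        [set u | residue u n = residue y n])
   => //= -[u v] /= [-> ->].
Qed.

HB.instance Definition _ :=
  PreTopologicalNmodule_isTopologicalZmodule.Build (padic_int p)
    padic_sub_continuous.
End PadicInt.

Section QuasiConvexity.
Variable R : realType.

Definition circle_plus : set (circle R) :=
  @circle_pi R @` `[- (1 / 4), 1 / 4].

Record character (G : topologicalZmodType) := Character {
  character_fun :> {additive G -> circle R};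
  character_continuous : continuous character_fun }.

Variable G : topologicalZmodType.

Definition polar (E : set G) : set (character G) :=
  [set chi | chi @` E `<=` circle_plus].

Definition prepolar (A : set (character G)) : set G :=
  [set x | forall chi, A chi -> circle_plus (chi x)].

Definition quasi_convex (E : set G) : Prop := E = prepolar (polar E).

End QuasiConvexity.
Arguments quasi_convex R {G} E.

Definition L_set (a : nat -> nat) (p : nat) : set (padic_int p) :=
  [set 0] `|`
  [set x | exists n, x = p%:R ^+ a n \/ x = - (p%:R ^+ a n)].
Arguments L_set a p : clear implicits.

(* Main.v *)
Require Import Defs.
From HB Require Import structures.
From mathcomp Require Import all_boot all_order all_algebra.
From mathcomp Require Import all_classical all_reals all_analysis.
From mathcomp Require Import zify ring lra.

Set Implicit Arguments.
Unset Strict Implicit.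
Unset Printing Implicit Defensive.

Import Order.TTheory GRing.Theory Num.Theory.
Import numFieldNormedType.Exports.

Local Open Scope classical_set_scope.
Local Open Scope ring_scope.

(** Write [X] for any integer congruent to [x] modulo [p ^ l.+1].  The proof
    tests a point [x] of the quasi-convex hull of [L_set a p] against the
    characters [x |-> m X / p ^ l.+1] only.  Their values at integers are
    rational numbers, so membership in [circle_plus] becomes an inequality
    between integers ([quarter_close], [padic_charP]), and such a character
    lies in the polar as soon as [m * p ^ a n / p ^ l.+1] is within 1/4 of an
    integer for every [n].

    A nonzero [x] has a first nonzero digit [c] in base [p], at position [k],
    which is chosen with [`|c| < p / 2] ([first_digit]).  If [x] is not
    [c * p ^ k], the difference has in turn a first digit [d], at a position
    [l > k].  Both digits are controlled by [hull_digit_pm1]: if the first [M]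
    multiples of a point of the circle stay in [circle_plus], this point is
    within [1 / (4 M)] of 0 ([small_multiples_quarter_close]).  At a position
    outside the range of [a] the multiples up to [M = p] are available, and no
    nonzero digit survives; at a position [a n] the multiples up to
    [M = p %/ 4] are, which leaves only the digits 1 and -1.

    It remains to exclude two nonzero digits.  With [M = p %/ 4] the multiplier
    [M (c d p ^ (l - k) + 1)] moves the digit [c] on top of [d] with the same
    sign, so that the value of the character at [x] is
    [+- 2 M / p +- M p ^ (k - l - 1)] modulo 1.  This lies strictly between 1/4
    and 3/4 in absolute value ([two_digits_not_close]), although the character
    is in the polar ([two_digit_multiplier_close]).  Both arguments rest on
    [p ^ 2 < 4 M (2 p - 1)] ([quarter_sq_gt]), and the second one also on
    [4 M <= p - 1], which holds because [p] is odd. *)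

(** * Membership in [circle_plus] as an integer inequality *)

(** The point [Y / N] of the circle lies in [circle_plus]. *)
Definition quarter_close (N Y : int) : Prop :=
  exists j : int, `|4 * (Y - j * N)| <= N.

Lemma circle_plusP (R : realType) (N Y : int) : 0 < N ->
  circle_plus (circle_pi (Y%:~R / N%:~R : R)) <-> quarter_close N Y.
Proof.
move=> N_gt0; have N_gt0R : 0 < N%:~R :> R by rewrite ltr0z.
have closeE (j : int) : (`|4 * (Y - j * N)| <= N) =
    (- (1 / 4) <= (Y%:~R / N%:~R - j%:~R : R) <= 1 / 4).
  rewrite -(ler_int R) intr_norm rmorphM rmorphB rmorphM /=.
  have -> : 4 * (Y%:~R - j%:~R * N%:~R) =
      4 * (Y%:~R / N%:~R - j%:~R) * N%:~R :> R by field; rewrite gt_eqF.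
  rewrite normrM (gtr0_norm N_gt0R) ger_pMl // ler_norml.
  by apply/idP/idP => ?; lra.
split=> [[r rI /circle_pi_eqP/intrP[i ri]]|[j]].
  exists (- i); rewrite closeE.
  move: rI; rewrite /= in_itv /= => rI.
  rewrite rmorphN /= -ri; lra.
rewrite closeE => Yj; exists (Y%:~R / N%:~R - j%:~R); first by rewrite /= in_itv.
apply/circle_pi_eqP/intrP; exists (- j); rewrite rmorphN /=; lra.
Qed.

Lemma small_quarter_close (N Y : int) : 4 * `|Y| <= N -> quarter_close N Y.
Proof. by move=> YN; exists 0; lia. Qed.

Lemma quarter_closeDl (N Y k : int) :
  quarter_close N (k * N + Y) <-> quarter_close N Y.
Proof.
split=> -[j jY]; [exists (j - k)|exists (k + j)].
  by rewrite (mulrBl N) opprB addrA [Y + _]addrC.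
by rewrite (mulrDl k) opprD addrACA subrr add0r.
Qed.

(** Between 1/4 and 3/4 there is no point of [circle_plus]; hence membership
    together with a crude bound improves to the sharp bound 1/4. *)
Lemma quarter_close_norm (N Y : int) :
  4 * `|Y| < 3 * N -> quarter_close N Y -> 4 * `|Y| <= N.
Proof.
move=> YN [j]; have [->|j_neq0] := eqVneq j 0; first by rewrite mul0r; lia.
have : N <= `|j * N| by rewrite normrM; nia.
lia.
Qed.

(** Induction on [M]: if [`|X / N| <= 1 / (4 M)], then the next multiple is at
    most [(M + 1) / (4 M) <= 1/2] in absolute value, so it cannot wrap around
    the circle and its membership in [circle_plus] is a bound on [X] itself. *)
Lemma small_multiples_quarter_close (N X : int) (M : nat) :
  2 * `|X| < N ->
  (forall m : nat, (0 < m <= M)%N -> quarter_close N (m%:Z * X)) ->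
  4 * M%:Z * `|X| <= N.
Proof.
move=> XN; elim: M => [|M IH] close; first by lia.
have {}IH : 4 * M%:Z * `|X| <= N.
  by apply: IH => m mM; apply: close; lia.
have normMX : `|M.+1%:Z * X| = M.+1%:Z * `|X| by rewrite normrM.
have := quarter_close_norm _ (close M.+1 ltac:(lia)).
rewrite normMX -mulrA; apply.
by case: M {close normMX} IH => [|M] IH; nia.
Qed.

(** * Digits of a p-adic integer *)

Section Digits.
Variable p : nat.
Hypothesis p_gt1 : (1 < p)%N.

Lemma Zp_modulus l : (Zp_trunc (p ^ l.+1)).+2 = (p ^ l.+1)%N.
Proof. by rewrite Zp_cast // -[1%N](exp1n l.+1) ltn_exp2r. Qed.

(** The projection with its order of arguments exchanged, so that it can carry
    the structure of a ring morphism. *)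
Definition reduction l (x : padic_int p) : 'Z_(p ^ l.+1) := residue x l.

Lemma reduction_is_zmod_morphism l : zmod_morphism (reduction l).
Proof. by []. Qed.
Lemma reduction_is_monoid_morphism l : monoid_morphism (reduction l).
Proof. by []. Qed.
HB.instance Definition _ l := GRing.isZmodMorphism.Build
  (padic_int p) 'Z_(p ^ l.+1) (reduction l) (reduction_is_zmod_morphism l).
HB.instance Definition _ l := GRing.isMonoidMorphism.Build
  (padic_int p) 'Z_(p ^ l.+1) (reduction l) (reduction_is_monoid_morphism l).

Lemma residue_intr l (z : int) : residue (z%:~R : padic_int p) l = z%:~R.
Proof. exact: (rmorph_int (reduction l)). Qed.

Lemma natr_Zp_eq0 l (n : nat) :
  (n%:R == 0 :> 'Z_(p ^ l.+1)) = (p ^ l.+1 %| n)%N.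
Proof.
by rewrite -val_eqE /= Zp_nat /= Zp_modulus.
Qed.

Lemma intr_Zp_eq0 l (z : int) :
  (p%:Z ^+ l.+1 %| z)%Z -> z%:~R = 0 :> 'Z_(p ^ l.+1).
Proof.
case/dvdzP => y ->; rewrite rmorphM rmorphXn /=.
suff -> : (p%:Z%:~R ^+ l.+1 : 'Z_(p ^ l.+1)) = 0 by rewrite mulr0.
by rewrite -natrX; apply/eqP; rewrite natr_Zp_eq0.
Qed.

(** The position [l] is the p-adic valuation of [x]. The digit is balanced, with
    absolute value below [p / 2] since [p] is odd: this bound keeps [x] modulo
    [p ^ l.+1] away from half the modulus. *)
Lemma first_digit (x : padic_int p) : x != 0 -> odd p ->
  exists l (d : int), [/\ residue x l = (d * p%:Z ^+ l)%:~R, residue x l != 0,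
    (forall j, (j < l)%N -> residue x j = 0), d != 0 & 2 * `|d| < p%:Z].
Proof.
move=> x_neq0 p_odd.
have [|l xl l_min] := @ex_minnP (fun l => residue x l != 0).
  apply: contrapT => /forallNP x0; move/eqP: x_neq0; apply; apply: padicP => n.
  by apply/eqP/negPn/negP/x0.
have x0 j : (j < l)%N -> residue x j = 0.
  by move=> jl; apply/eqP; apply: contraTT jl => /l_min; rewrite -leqNgt.
have [c cE] : exists c, val (residue x l) = (c * p ^ l)%N.
  apply/dvdnP; case: l xl x0 {l_min} => [|l] _ x0; first by rewrite dvd1n.
  have := x0 l (ltnSn l); rewrite residueS => /eqP.
  by rewrite natr_Zp_eq0.
have pl_gt0 : (0 < p ^ l)%N by rewrite expn_gt0; lia.
have c_gt0 : (0 < c)%N.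
  rewrite lt0n; apply: contraNneq xl => c0.
  by rewrite -val_eqE /= cE c0.
have c_ltp : (c < p)%N.
  have := ltn_ord (residue x l); rewrite [X in (_ < X)%N -> _]Zp_modulus.
  by rewrite [X in (X < _)%N -> _]cE expnS ltn_pmul2r.
have xE : residue x l = (c%:Z * p%:Z ^+ l)%:~R.
  by rewrite -[LHS]natr_Zp cE natrM natrX rmorphM rmorphXn.
exists l; have [c_small|c_large] := leqP (c * 2) p.
  exists c%:Z; split=> //; lia.
(* A digit above p / 2 is replaced by its negative representative modulo p. *)
exists (c%:Z - p%:Z); split=> //; try lia.
rewrite xE mulrBl rmorphB -exprS /=.
by rewrite [X in _ - X]intr_Zp_eq0 ?subr0 ?dvdzz.
Qed.

(** * Characters of the p-adic integers *)

Variable R : realType.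

Definition Zp_circle l (z : 'Z_(p ^ l.+1)) : circle R :=
  circle_pi ((val z)%:R / (p%:R ^+ l.+1)).

Lemma Zp_circleB l : zmod_morphism (@Zp_circle l).
Proof.
have p_neq0 : p%:R ^+ l.+1 != 0 :> R.
  by rewrite expf_neq0 // pnatr_eq0; lia.
move=> z t; rewrite /Zp_circle -raddfB; apply/circle_pi_eqP.
have [j jE] : exists j : int,
    (val (z - t))%:Z = (val z)%:Z - (val t)%:Z + j * p%:Z ^+ l.+1.
  have := ltn_ord t; rewrite /=.
  move: (nat_of_ord z) (nat_of_ord t) => u v; rewrite Zp_modulus => v_lt.
  have := divn_eq (u + (p ^ l.+1 - v) %% p ^ l.+1)%N (p ^ l.+1).
  have := divn_eq (p ^ l.+1 - v)%N (p ^ l.+1).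
  set i := (_ %/ _)%N; set k := (_ %/ _)%N => h1 h2.
  exists (1 - i%:Z - k%:Z); rewrite -[p%:Z]natz -natrX natz; lia.
apply/intrP; exists j.
have -> : (val (z - t))%:R = (val z)%:R - (val t)%:R + j%:~R * p%:R ^+ l.+1 :> R.
  have := congr1 (fun i : int => i%:~R : R) jE.
  by rewrite rmorphD rmorphB rmorphM rmorphXn.
by field.
Qed.
HB.instance Definition _ l := GRing.isZmodMorphism.Build
  'Z_(p ^ l.+1) (circle R) (@Zp_circle l) (@Zp_circleB l).

(** By additivity it is enough to compare the two sides at 1. *)
Lemma Zp_circle_intr l (z : int) :
  Zp_circle (z%:~R : 'Z_(p ^ l.+1)) = circle_pi (z%:~R / (p%:Z ^+ l.+1)%:~R).
Proof.
have -> : z%:~R / (p%:Z ^+ l.+1)%:~R = (1 / p%:R ^+ l.+1) *~ z :> R.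
  by rewrite -[RHS]mulrzl rmorphXn /= mulrA mulr1.
by rewrite raddfMz raddfMz; congr (_ *~ _).
Qed.

Definition padic_char_fun (m : int) l (x : padic_int p) : circle R :=
  Zp_circle (m%:~R * residue x l).

Lemma padic_char_funB m l : zmod_morphism (padic_char_fun m l).
Proof. by move=> x y; rewrite -raddfB -mulrBr. Qed.
HB.instance Definition _ m l := GRing.isZmodMorphism.Build
  (padic_int p) (circle R) (padic_char_fun m l) (padic_char_funB m l).

(** The character factors through the discrete group [Z / p ^ l.+1]. *)
Lemma padic_char_continuous m l : continuous (padic_char_fun m l).
Proof.
move=> x; apply: (@continuous_comp _ (discrete_topology 'Z_(p ^ l.+1)) _
  (fun x => residue x l) (fun z => Zp_circle (m%:~R * z))).
  exact: residue_continuous.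
move=> U /nbhs_singleton Ux.
rewrite nbhs_filterE /fmap /=.
suff : principal_filter (residue x l) [set z | U (Zp_circle (m%:~R * z))].
  by rewrite -(@nbhs_principalE (discrete_topology 'Z_(p ^ l.+1))).
exact/principal_filterP.
Qed.

Definition padic_char m l : character R (padic_int p) :=
  @Character R (padic_int p) (padic_char_fun m l) (@padic_char_continuous m l).

Lemma padic_charP m l x (X : int) : residue x l = X%:~R ->
  circle_plus (padic_char m l x) <-> quarter_close (p%:Z ^+ l.+1) (m * X).
Proof.
move=> xX; rewrite /= /padic_char_fun xX -intrM Zp_circle_intr.
by apply: circle_plusP; rewrite exprn_gt0 //; lia.
Qed.

Lemma padic_char_polar (a : nat -> nat) m l :
  (forall n, quarter_close (p%:Z ^+ l.+1) (m * p%:Z ^+ a n)) ->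
  polar (L_set a p) (padic_char m l).
Proof.
move=> close _ [x Lx <-].
have [X [xX]] : exists X : int, x = X%:~R /\ quarter_close (p%:Z ^+ l.+1) (m * X).
  case: Lx => [->|[n [->|->]]].
  - exists 0; split=> //; exists 0; rewrite mul0r subr0 mulr0 normr0.
    by rewrite exprn_ge0.
  - by exists (p%:Z ^+ a n); split; [rewrite rmorphXn|].
  - exists (- p%:Z ^+ a n); split; first by rewrite rmorphN rmorphXn.
    have [j jE] := close n; exists (- j).
    by rewrite mulrN mulNr -opprD mulrN normrN.
have /padic_charP charP : residue x l = X%:~R by rewrite xX residue_intr.
by move=> ?; apply/charP.
Qed.

End Digits.

(** * The digits of a point of the hull *)

(** For [p >= 7] this follows from [p - 3 <= 4 (p %/ 4)]; the cases 5 and 6 are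
    checked directly, as [p - 3] is too small there. *)
Lemma quarter_sq_gt (p : nat) : (5 <= p)%N ->
  p%:Z ^+ 2 < 4 * (p %/ 4)%N%:Z * (2 * p%:Z - 1).
Proof.
move=> p_ge5; have [->|p_neq5] := eqVneq p 5%N; first by [].
have [->|p_neq6] := eqVneq p 6%N; first by [].
have : (p <= 4 * (p %/ 4) + 3)%N by lia.
move: (p %/ 4)%N => M.
have : (7 <= p)%N by lia.
nia.
Qed.

(** The term [e] stands for the lower part of [x]: it is 0 for the first nonzero
    digit, and the contribution of the first digit for the second one. Its size
    is what makes [`|X / p ^ l.+1|] at least [(`|d| - 1 / p) / p]. *)
Lemma hull_digit_pm1 (R : realType) (p : nat) (a : nat -> nat)
    (x : padic_int p) l (e d : int) :
  (5 <= p)%N ->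
  prepolar (polar (L_set a p) : set (character R (padic_int p))) x ->
  residue x l = (e + d * p%:Z ^+ l)%:~R ->
  p%:Z * `|e| <= p%:Z ^+ l -> d != 0 -> 2 * `|d| < p%:Z ->
  (exists n, a n = l) /\ `|d| = 1.
Proof.
move=> p_ge5 hull_x xE e_small d_neq0 d_small.
have p_gt1 : (1 < p)%N by lia.
set q := p%:Z ^+ l in xE e_small.
have q_gt0 : 0 < q by rewrite exprn_gt0 //; lia.
have X_small : 2 * `|e + d * q| < p%:Z ^+ l.+1.
  rewrite exprS -/q.
  have : `|e + d * q| <= `|e| + `|d| * q.
    by rewrite (le_trans (ler_normD _ _)) // normrM (gtr0_norm q_gt0).
  nia.
have X_large : (`|d| * p%:Z - 1) * q <= p%:Z * `|e + d * q|.
  have : `|d * q| <= `|e + d * q| + `|e| by lia.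
  rewrite normrM (gtr0_norm q_gt0); nia.
have multiples M :
    (forall m n, (m <= M)%N ->
       quarter_close (p%:Z ^+ l.+1) (m%:Z * p%:Z ^+ a n)) ->
    4 * M%:Z * `|e + d * q| <= p%:Z ^+ l.+1.
  move=> close; apply: small_multiples_quarter_close => // m mM.
  apply/(padic_charP p_gt1 R m%:Z xE)/hull_x/padic_char_polar => n.
  by apply: close; lia.
have power_close (m b : nat) :
    (4 * m%:Z * p%:Z ^+ b <= p%:Z ^+ l.+1) \/ (l < b)%N ->
    quarter_close (p%:Z ^+ l.+1) (m%:Z * p%:Z ^+ b).
  case=> [mb|lb].
    by apply: small_quarter_close; rewrite ger0_norm ?mulrA ?mulr_ge0 ?exprn_ge0.
  rewrite -(subnK lb) exprD mulrA -[X in quarter_close _ X]addr0.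
  by rewrite quarter_closeDl; apply: small_quarter_close; rewrite exprn_ge0.
have l_in : exists n, a n = l.
  apply: contrapT => l_notin.
  (* The exponents a n that matter are now below l, which leaves room for the
     multiples up to p: 4 p p^(a n) <= 4 p^l < p^(l+1). *)
  have : 4 * p%:Z * `|e + d * q| <= p%:Z ^+ l.+1.
    apply: multiples => m n mp; apply: power_close.
    have [lan|anl] := ltnP l (a n); [by right|left].
    have {}anl : (a n < l)%N.
      by rewrite ltn_neqAle anl andbT; apply: contra_notN l_notin => /eqP; exists n.
    have := ler_weXn2l (x := p%:Z) ltac:(lia) anl.
    have := exprn_ge0 (a n) (ler0n int p).
    rewrite !exprS -/q natz; nia.
  rewrite exprS -/q; nia.
split=> //.
(* A digit of absolute value at least 2 would now give 4 M (2 p - 1) <= p^2. *)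
have : 4 * (p %/ 4)%N%:Z * `|e + d * q| <= p%:Z ^+ l.+1.
  apply: multiples => m n mp; apply: power_close.
  have [lan|anl] := ltnP l (a n); [by right|left].
  rewrite exprS ler_pM ?exprn_ge0 ?mulr_ge0 //; first by lia.
  by rewrite ler_weXn2l //; lia.
rewrite exprS -/q => h.
have := quarter_sq_gt p_ge5.
set M := (p %/ 4)%N%:Z in h * => M_big.
have hp : 4 * M * (`|d| * p%:Z - 1) * q <= p%:Z ^+ 2 * q by nia.
have {}hp : 4 * M * (`|d| * p%:Z - 1) <= p%:Z ^+ 2 by rewrite ler_pM2r in hp.
nia.
Qed.

(** * Excluding a second digit *)

(** Modulo [p ^ l.+1] the multiplier sends [p ^ b] to 0 for [l < b], to
    [M p ^ b] for [k < b <= l], and to [M (s p ^ (l - k + b) + p ^ b)] for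
    [b <= k]. In the last case, the critical one, the size is at most
    [M (1 + 1 / p) p ^ l], and [4 M <= p - 1] gives
    [4 M (1 + 1 / p) <= p - 1 / p < p]. *)
Lemma two_digit_multiplier_close (p k l b M : nat) (s : int) :
  (k < l)%N -> `|s| = 1 -> 4 * M%:Z <= p%:Z - 1 ->
  quarter_close (p%:Z ^+ l.+1) (M%:Z * (s * p%:Z ^+ (l - k) + 1) * p%:Z ^+ b).
Proof.
move=> kl s1 Mp; have P_ge1 : 1 <= p%:Z by lia.
have powS_le i j : (i < j)%N -> p%:Z * p%:Z ^+ i <= p%:Z ^+ j.
  by move=> ij; rewrite -exprS ler_weXn2l.
have pow_gt0 i : 0 < p%:Z ^+ i by rewrite exprn_gt0 //; lia.
have [lb|bl] := ltnP l b.
  rewrite -(subnK lb) exprD mulrA -[X in quarter_close _ X]addr0.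
  by rewrite quarter_closeDl; apply: small_quarter_close; rewrite exprn_ge0.
have [kb|bk] := ltnP k b.
  have -> : M%:Z * (s * p%:Z ^+ (l - k) + 1) * p%:Z ^+ b =
      M%:Z * s * p%:Z ^+ (b - k.+1) * p%:Z ^+ l.+1 + M%:Z * p%:Z ^+ b.
    have -> : M%:Z * s * p%:Z ^+ (b - k.+1) * p%:Z ^+ l.+1 =
        M%:Z * s * (p%:Z ^+ (l - k) * p%:Z ^+ b).
      by rewrite -mulrA -!exprD; congr (_ * _ ^+ _); lia.
    by ring.
  rewrite quarter_closeDl; apply: small_quarter_close.
  rewrite exprS normrM (gtr0_norm (pow_gt0 b)).
  have := pow_gt0 b; have : p%:Z ^+ b <= p%:Z ^+ l by rewrite ler_weXn2l.
  move: (p%:Z ^+ b) (p%:Z ^+ l); nia.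
apply: small_quarter_close.
have -> : M%:Z * (s * p%:Z ^+ (l - k) + 1) * p%:Z ^+ b =
    M%:Z * (s * p%:Z ^+ (l - k + b) + p%:Z ^+ b) by rewrite exprD; ring.
rewrite normrM (mulrA 4).
have := powS_le b l ltac:(lia).
have : p%:Z ^+ (l - k + b) <= p%:Z ^+ l by rewrite ler_weXn2l //; lia.
rewrite exprS; move: (pow_gt0 b) (pow_gt0 (l - k + b)%N).
move: (p%:Z ^+ b) (p%:Z ^+ (l - k + b)) (p%:Z ^+ l) => B S Q B0 S0 SQ BQ.
have h : `|s * S + B| <= Q + B.
  by rewrite (le_trans (ler_normD _ _)) // normrM s1; lia.
have : 4 * M%:Z * `|s * S + B| <= (p%:Z - 1) * (Q + B) by rewrite ler_pM.
lia.
Qed.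

(** The multiplier maps [c p ^ k] to [M d p ^ l + M c p ^ k] and [d p ^ l] to
    [M d p ^ l] modulo [p ^ l.+1], because [c ^ 2 = d ^ 2 = 1]. The two copies of
    [M d p ^ l] add up, and the remainder [M c p ^ k] is too small to bring the
    sum back to [circle_plus]. *)
Lemma two_digits_not_close (p k l : nat) (c d : int) : (5 <= p)%N -> odd p ->
  (k < l)%N -> `|c| = 1 -> `|d| = 1 ->
  ~ quarter_close (p%:Z ^+ l.+1) ((p %/ 4)%N%:Z * (c * d * p%:Z ^+ (l - k) + 1)
                                  * (c * p%:Z ^+ k + d * p%:Z ^+ l)).
Proof.
move=> p_ge5 p_odd kl c1 d1.
have P_ge1 : 1 <= p%:Z by lia.
have cc : c * c = 1 by nia.
have dd : d * d = 1 by nia.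
have M_big := quarter_sq_gt p_ge5.
have M_small : 4 * (p %/ 4)%N%:Z <= p%:Z - 1 by lia.
move: (p %/ 4)%N%:Z M_big M_small => M M_big M_small.
have -> : M * (c * d * p%:Z ^+ (l - k) + 1) * (c * p%:Z ^+ k + d * p%:Z ^+ l) =
    M * c * p%:Z ^+ (l - k).-1 * p%:Z ^+ l.+1 +
    M * (2 * d * p%:Z ^+ l + c * p%:Z ^+ k).
  have lE : p%:Z ^+ l = p%:Z ^+ (l - k).-1 * p%:Z * p%:Z ^+ k.
    by rewrite -exprSr -exprD; congr (_ ^+ _); lia.
  have -> : p%:Z ^+ (l - k) = p%:Z ^+ (l - k).-1 * p%:Z.
    by rewrite -exprSr; congr (_ ^+ _); lia.
  rewrite exprS.
  transitivity (M * (c * p%:Z ^+ k + d * p%:Z ^+ l)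
    + M * d * (c * c) * (p%:Z ^+ (l - k).-1 * p%:Z * p%:Z ^+ k)
    + M * c * (d * d) * p%:Z ^+ (l - k).-1 * p%:Z * p%:Z ^+ l); first by ring.
  by rewrite cc dd -lE; ring.
rewrite quarter_closeDl.
have : p%:Z * p%:Z ^+ k <= p%:Z ^+ l by rewrite -exprS ler_weXn2l.
have : 0 < p%:Z ^+ k by rewrite exprn_gt0 //; lia.
rewrite exprS; move: (p%:Z ^+ k) (p%:Z ^+ l) => K Q K_gt0 KQ.
have Q_gt0 : 0 < Q by nia.
set Y := M * _ => Y_close.
have dQ : `|2 * d * Q| = 2 * Q by rewrite !normrM d1; lia.
have cK : `|c * K| = K by rewrite normrM c1; lia.
have YE : `|Y| = M * `|2 * d * Q + c * K| by rewrite normrM ger0_norm //; nia.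
have Y_large : p%:Z * Q < 4 * `|Y|.
  have Z_large : (2 * p%:Z - 1) * Q <= p%:Z * `|2 * d * Q + c * K|.
    have : 2 * Q - K <= `|2 * d * Q + c * K| by lia.
    nia.
  rewrite YE -(ltr_pM2l (x := p%:Z)); last by lia.
  have := ler_wpM2l (x := 4 * M) ltac:(lia) Z_large.
  have : p%:Z ^+ 2 * Q < 4 * M * (2 * p%:Z - 1) * Q by rewrite ltr_pM2r.
  lia.
have Y_small : 4 * `|Y| < 2 * (p%:Z * Q).
  have Z_small : p%:Z * `|2 * d * Q + c * K| <= (2 * p%:Z + 1) * Q.
    have : `|2 * d * Q + c * K| <= 2 * Q + K by lia.
    nia.
  rewrite YE -(ltr_pM2l (x := p%:Z)); last by lia.
  have := ler_wpM2l (x := 4 * M) ltac:(lia) Z_small.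
  have : 4 * M * ((2 * p%:Z + 1) * Q) <= (p%:Z - 1) * ((2 * p%:Z + 1) * Q).
    by rewrite ler_wpM2r //; nia.
  have : 0 < p%:Z * Q by nia.
  lia.
by have := quarter_close_norm _ Y_close; lia.
Qed.

Theorem theoremB (R : realType) (p : nat) (p_prime : prime p) (p_ge5 : (5 <= p)%N)
    (a : nat -> nat) (a_incr : forall n : nat, (a n < a n.+1)%N) :
  quasi_convex R (L_set a p).
Proof.
have p_gt1 : (1 < p)%N by lia.
have p_odd : odd p by case: (even_prime p_prime) => // p2; lia.
have P_ge1 : 1 <= p%:Z by lia.
apply/seteqP; split => [x Lx chi chiE|x hull_x]; first by apply: chiE; exists x.
have [->|x_neq0] := eqVneq x 0; first by left.
have [k [c [xk _ x_below c_neq0 c_small]]] := first_digit p_gt1 x_neq0 p_odd.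
have [[n an] c1] : (exists n, a n = k) /\ `|c| = 1.
  have xk0 : residue x k = (0 + c * p%:Z ^+ k)%:~R by rewrite add0r.
  apply: (hull_digit_pm1 p_ge5 hull_x xk0) => //.
  by rewrite normr0 mulr0 exprn_ge0.
have [x_eq|y_neq0] := eqVneq (x - (c * p%:Z ^+ k)%:~R) 0.
  right; exists n; move/eqP: x_eq; rewrite subr_eq0 => /eqP ->.
  rewrite rmorphM rmorphXn /= an.
  have [-> | ->] : c = 1 \/ c = -1 by lia.
    by left; rewrite mul1r.
  by right; rewrite mulN1r.
have [l [d [yl yl_neq0 _ d_neq0 d_small]]] := first_digit p_gt1 y_neq0 p_odd.
(* Subtracting the first digit clears every residue up to level k. *)
have kl : (k < l)%N.
  rewrite ltnNge leq_eqVlt; apply: contra yl_neq0 => /orP[/eqP ->|lk].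
    by rewrite /= xk residue_intr subrr.
  rewrite /= x_below // residue_intr intr_Zp_eq0 ?subrr //.
  by rewrite dvdz_mull // dvdz_exp2l.
have xl : residue x l = (c * p%:Z ^+ k + d * p%:Z ^+ l)%:~R.
  by rewrite rmorphD /= -yl /= residue_intr addrC subrK.
have pkl : p%:Z * p%:Z ^+ k <= p%:Z ^+ l by rewrite -exprS ler_weXn2l.
have [_ d1] : (exists n, a n = l) /\ `|d| = 1.
  apply: (hull_digit_pm1 p_ge5 hull_x xl) => //.
  by rewrite normrM c1 mul1r ger0_norm ?exprn_ge0.
case: (two_digits_not_close p_ge5 p_odd kl c1 d1).
apply/(padic_charP p_gt1 R _ xl)/hull_x/padic_char_polar => j.
apply: two_digit_multiplier_close => //; first by rewrite normrM c1 d1.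
by lia.
Qed.
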